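(* Let $(p_n)_{n\ge1}$ and $(q_n)_{n\ge1}$ be sequences of real numbers with $0<q_n<p_n\le 1$ for all $n$, such that $p_n\to 1$, $q_n\to 1$, $p_n^{\,n}\to a$ and $q_n^{\,n}\to b$ as $n\to\infty$, where $a,b$ are real numbers. Let $f\in C^2([0,1]\times[0,1])$. Then for every $(x,y)\in[0,1]\times[0,1]$, $$\lim_{n\to\infty}[n]_{p_n,q_n}\left(B^{(p_n,q_n)}_{n,n}(f;x,y)-f(x,y)\right)=\frac{(ax-ax^2)}{2}\,\frac{\partial^2 f}{\partial x^2}(x,y)+\frac{(ay-ay^2)}{2}\,\frac{\partial^2 f}{\partial y^2}(x,y).$$
   Context: For $0<q<p\le 1$ and an integer $n\ge 0$, put $[n]_{p,q}=\frac{p^n-q^n}{p-q}$, $[n]_{p,q}!=[n]_{p,q}[n-1]_{p,q}\cdots[1]_{p,q}$ for $n\ge 1$, $[0]_{p,q}!=1$, and, for $0\le k\le n$, $\binom{n}{k}_{p,q}=\frac{[n]_{p,q}!}{[k]_{p,q}!\,[n-k]_{p,q}!}$. For $n\ge 1$ and $0\le k\le n$ let $$R_{n,k}(p,q;x)=p^{\frac{k(k-1)-n(n-1)}{2}}\binom{n}{k}_{p,q}x^k\prod_{s=0}^{n-k-1}(p^s-q^s x)$$ (an empty product equals $1$). For $0<q<p\le 1$, an integer $n\ge 1$, $f:[0,1]^2\to\mathbb{R}$ and $(x,y)\in[0,1]^2$, the bivariate $(p,q)$-Bernstein operator (with the same parameters and degree in both variables) is $$B^{(p,q)}_{n,n}(f;x,y)=\sum_{k=0}^{n}\sum_{j=0}^{n}R_{n,k}(p,q;x)\,R_{n,j}(p,q;y)\,f\!\left(\frac{[k]_{p,q}}{[n]_{p,q}p^{k-n}},\frac{[j]_{p,q}}{[n]_{p,q}p^{j-n}}\right).$$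 $C^2([0,1]\times[0,1])$ is the space of functions $f$ such that $f$, $\frac{\partial^j f}{\partial x^j}$ and $\frac{\partial^j f}{\partial y^j}$ ($j=1,2$) are continuous real-valued functions on $[0,1]^2$ (one-sided derivatives at the boundary). *)

(* Defs.v *)
From HB Require Import structures.
From mathcomp Require Import all_boot all_order all_algebra.
From mathcomp Require Import all_classical all_reals all_analysis.
Set Implicit Arguments.
Unset Strict Implicit.
Unset Printing Implicit Defensive.
Import Order.TTheory GRing.Theory Num.Theory.
Import numFieldNormedType.Exports.
Local Open Scope classical_set_scope.
Local Open Scope ring_scope.

Definition pq_int (R : realType) (p q : R) (n : nat) : R :=
  (p ^+ n - q ^+ n) / (p - q).

Definition pq_fact (R : realType) (p q : R) (n : nat) : R :=
  \prod_(1 <= i < n.+1) pq_int p q i.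

Definition pq_binom (R : realType) (p q : R) (n k : nat) : R :=
  pq_fact p q n / (pq_fact p q k * pq_fact p q (n - k)).

(* Only used for k <= n. The exponent of p is an integer (nonpositive, as
   k <= n), and the two halves are exact since m * (m - 1) is even. *)
Definition pq_basis (R : realType) (p q : R) (n k : nat) (x : R) : R :=
  p ^ ((k * k.-1)./2%:Z - (n * n.-1)./2%:Z) * pq_binom p q n k * x ^+ k *
  \prod_(0 <= s < n - k) (p ^+ s - q ^+ s * x).

Definition pq_node (R : realType) (p q : R) (n k : nat) : R :=
  pq_int p q k / (pq_int p q n * p ^ (k%:Z - n%:Z)).

(* A function on [0,1]^2 is represented by a total function on R * R; for
   0 < q < p all nodes lie in [0,1], so values off the square are not used. *)
Definition pq_bernstein2 (R : realType) (p q : R) (n : nat)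
    (f : R * R -> R) (z : R * R) : R :=
  \sum_(0 <= k < n.+1) \sum_(0 <= j < n.+1)
    pq_basis p q n k z.1 * pq_basis p q n j z.2 *
    f (pq_node p q n k, pq_node p q n j).

Definition unit_square (R : realType) : set (R * R) := `[0, 1] `*` `[0, 1].

(* Difference quotients are taken along t in [0,1], t <> x: this is the
   ordinary derivative for 0 < x < 1 and the one-sided one for x = 0, 1.
   When the limit does not exist, the value of [derive01] is unspecified. *)
Definition derivable01 (R : realType) (g : R -> R) (x : R) : Prop :=
  cvg ((g t - g x) / (t - x) @[t --> within `[0, 1] x^']).

Definition derive01 (R : realType) (g : R -> R) (x : R) : R :=
  lim ((g t - g x) / (t - x) @[t --> within `[0, 1] x^']).

Definition partial1 (R : realType) (f : R * R -> R) (z : R * R) : R :=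
  derive01 (fun t => f (t, z.2)) z.1.

Definition partial2 (R : realType) (f : R * R -> R) (z : R * R) : R :=
  derive01 (fun t => f (z.1, t)) z.2.

Definition partial1_exists (R : realType) (f : R * R -> R) : Prop :=
  forall z, unit_square z -> derivable01 (fun t => f (t, z.2)) z.1.

Definition partial2_exists (R : realType) (f : R * R -> R) : Prop :=
  forall z, unit_square z -> derivable01 (fun t => f (z.1, t)) z.2.

(* Only pure second-order partial derivatives are involved: nothing is
   required of the mixed ones. *)
Definition C2_square (R : realType) (f : R * R -> R) : Prop :=
  [/\ {within @unit_square R, continuous f},
      [/\ partial1_exists f,
          {within @unit_square R, continuous (partial1 f)},
          partial1_exists (partial1 f)
        & {within @unit_square R, continuous (partial1 (partial1 f))}]
    & [/\ partial2_exists f,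
          {within @unit_square R, continuous (partial2 f)},
          partial2_exists (partial2 f)
        & {within @unit_square R, continuous (partial2 (partial2 f))}]].

(* Main.v *)
Require Import Defs.
From HB Require Import structures.
From mathcomp Require Import all_boot all_order all_algebra.
From mathcomp Require Import all_classical all_reals all_analysis.
From mathcomp Require Import ring lra.
Import Order.TTheory GRing.Theory Num.Theory.
Import numFieldNormedType.Exports.
Local Open Scope classical_set_scope.
Local Open Scope ring_scope.

(* With [r = q / p], the operator is a tensor square of Phillips' q-Bernstein
   operator of base [r]: a mean over the random node [T / N], where [T = [k]_r]
   and [N = [n]_r]. The absorption identity
   [E_(n+1) (T G(k)) = [n+1]_r x E_n (G(k+1))] computes all moments. The node
   has mean [x], variance [(x - x^2) / N], and fourth central moment [o(1 / N)]
   because [r -> 1], which also forces [N -> oo]. Expanding [f] first in the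
   first variable at the moving ordinate [v], then in the second one at the
   fixed abscissa [x], needs no mixed derivative: the linear term
   [f_x (x, v) (u - x)] is killed by the mean over [u] whatever its dependence
   on [v]. Finally [[n]_(p,q) = p^(n-1) N] and [p^(n-1) -> a]. *)

(** * Reduction to the single base [r = q / p] *)

Section QBernstein.
Context {R : realType}.
Implicit Types (p q r x : R) (n k : nat) (G : nat -> R).

Lemma pq_intD r m n : r != 1 ->
  pq_int 1 r (m + n) = pq_int 1 r m + r ^+ m * pq_int 1 r n.
Proof.
move=> r1; rewrite /pq_int !expr1n exprD.
have d0 : 1 - r != 0 by rewrite subr_eq0 eq_sym.
by field.
Qed.

Lemma pq_int1 r : r != 1 -> pq_int 1 r 1 = 1.
Proof. by move=> r1; rewrite /pq_int !expr1 divff // subr_eq0 eq_sym. Qed.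

Lemma pq_intS r n : r != 1 -> pq_int 1 r n.+1 = 1 + r * pq_int 1 r n.
Proof. by move=> r1; rewrite -add1n pq_intD// pq_int1. Qed.

Lemma pq_int0 p q : pq_int p q 0 = 0.
Proof. by rewrite /pq_int !expr0 subrr mul0r. Qed.

Lemma pq_int_gt0 p q n : 0 < q -> q < p -> (0 < n)%N -> 0 < pq_int p q n.
Proof.
move=> q0 qp n0; rewrite /pq_int divr_gt0 ?subr_gt0//.
by rewrite ltrXn2r ?nnegrE -?lt0n// ltW// (lt_trans q0).
Qed.

Lemma pq_fact0 p q : pq_fact p q 0 = 1.
Proof. by rewrite /pq_fact big_geq. Qed.

Lemma pq_factS p q n : pq_fact p q n.+1 = pq_fact p q n * pq_int p q n.+1.
Proof. by rewrite /pq_fact big_nat_recr. Qed.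

Lemma pq_fact_gt0 p q n : 0 < q -> q < p -> 0 < pq_fact p q n.
Proof.
move=> q0 qp; elim: n => [|n IH]; first by rewrite pq_fact0.
by rewrite pq_factS mulr_gt0// pq_int_gt0.
Qed.

(** Numerator and denominator are homogeneous in [(p, q)], of degrees [n.+1] and 1, which leaves the
    factor [p ^+ n]. *)
Lemma pq_intE p q n : p != 0 -> p != q ->
  pq_int p q n.+1 = p ^+ n * pq_int 1 (q / p) n.+1.
Proof.
move=> p0 pq; rewrite /pq_int expr1n expr_div_n.
have pq0 : p - q != 0 by rewrite subr_eq0.
have d0 : 1 - q / p != 0.
  by rewrite (_ : _ - _ = (p - q) / p) ?mulf_neq0 ?invr_eq0//; field.
rewrite exprS.
by field; rewrite p0 pq0 expf_neq0.
Qed.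

(** The exponent ['C(n, 2)] is 0 + 1 + ... + (n - 1), collected from [pq_intE] over the factors. *)
Lemma pq_factE p q n : p != 0 -> p != q ->
  pq_fact p q n = p ^+ 'C(n, 2) * pq_fact 1 (q / p) n.
Proof.
move=> p0 pq; elim: n => [|n IH]; first by rewrite !pq_fact0 mul1r.
by rewrite !pq_factS IH pq_intE// binS bin1 exprD; ring.
Qed.

Lemma exprz_subn p m n : p != 0 -> p ^ (m%:Z - n%:Z) = p ^+ m / p ^+ n.
Proof. by move=> p0; rewrite expfzDr// -exprnN. Qed.

(* With [r = q / p] the powers of [p] in the basis cancel: the operator is the
   classical Phillips [q]-Bernstein operator with base [r]. *)
Lemma pq_basisE p q n k x : p != 0 -> p != q -> (k <= n)%N ->
  pq_basis p q n k x = pq_basis 1 (q / p) n k x.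
Proof.
move=> p0 pq kn; rewrite /pq_basis exp1rz exprz_subn// -!bin2 /pq_binom.
rewrite !(pq_factE _ _ _ p0 pq).
rewrite [in LHS](_ : \prod_(0 <= s < n - k) _ = p ^+ 'C(n - k, 2) *
  \prod_(0 <= s < n - k) (1 ^+ s - (q / p) ^+ s * x)); last first.
  elim: (n - k)%N => [|m IH]; first by rewrite !big_geq// mulr1.
  rewrite !big_nat_recr//= IH binS bin1 exprD expr_div_n expr1n.
  by field; rewrite expf_neq0.
have h (m : nat) : p ^+ m != 0 by rewrite expf_neq0.
move: (pq_fact _ _ k) (pq_fact _ _ (n - k)) (pq_fact _ _ n) => a b c.
set P := \prod_(_ <= _ < _) _; rewrite !invfM; set a' := a^-1; set b' := b^-1.
by field; rewrite !h.
Qed.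

Lemma pq_nodeE p q n k : p != 0 -> p != q ->
  pq_node p q n.+1 k = pq_int 1 (q / p) k / pq_int 1 (q / p) n.+1.
Proof.
move=> p0 pq; case: k => [|k]; first by rewrite /pq_node !pq_int0 !mul0r.
have h (m : nat) : p ^+ m != 0 by rewrite expf_neq0.
rewrite /pq_node exprz_subn// !(pq_intE _ _ _ p0 pq).
move: (pq_int _ _ k.+1) (pq_int _ _ n.+1) => a b.
(* With the inverse kept as an atom [b'], the side conditions of [field] concern powers of [p]
   only. *)
rewrite !invfM invrK !exprS; set b' := b^-1.
by field; rewrite p0 !h.
Qed.

(** Expectation of [G k] for a random index [k]: when [0 < r < 1] and [0 <= x <= 1], the weights
    form a probability by [pq_basis_ge0] and [qmean1]. *)
Definition qmean r n x G := \sum_(0 <= k < n.+1) pq_basis 1 r n k x * G k.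

Lemma pq_basis0 r x : pq_basis 1 r 0 0 x = 1.
Proof.
rewrite /pq_basis exp1rz /pq_binom subnn pq_fact0 expr0 big_geq//.
by rewrite !mulr1 invr1 ?mulr1 ?mul1r.
Qed.

Lemma pq_basis1E r n k x : pq_basis 1 r n k x =
  pq_binom 1 r n k * x ^+ k * \prod_(0 <= s < n - k) (1 - r ^+ s * x).
Proof.
rewrite /pq_basis exp1rz mul1r; congr (_ * _).
by apply: eq_bigr => s _; rewrite expr1n.
Qed.

(** * Total mass and moments of the q-Bernstein weights *)

Section Moments.
Context (r x : R).
Hypotheses (r0 : 0 < r) (r1 : r < 1).

Let rn1 : r != 1. Proof. by rewrite lt_eqF. Qed.
Let fact_neq0 n : pq_fact 1 r n != 0.
Proof. by rewrite gt_eqF// pq_fact_gt0. Qed.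
Let int_neq0 n : pq_int 1 r n.+1 != 0.
Proof. by rewrite gt_eqF// pq_int_gt0. Qed.

Lemma pq_basis_ge0 n k : 0 <= x <= 1 -> 0 <= pq_basis 1 r n k x.
Proof.
move=> /andP[x0 x1]; rewrite pq_basis1E.
have f0 m : 0 <= pq_fact 1 r m by rewrite ltW// pq_fact_gt0.
apply: mulr_ge0; first by rewrite mulr_ge0 ?exprn_ge0// divr_ge0// mulr_ge0.
apply: prodr_ge0 => s _; rewrite subr_ge0 mulr_ile1//.
- by rewrite exprn_ge0 ?ltW.
- by rewrite exprn_ile1 ?ltW.
Qed.

(** The factor [[k+1]] cancels in [[k+1]!], while [[n+1]] leaves [[n+1]!] and one [x] leaves
    [x ^+ k.+1]; the product is unchanged because it depends on [n - k] only. *)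
Lemma pq_basis_absorb n k : (k <= n)%N ->
  pq_int 1 r k.+1 * pq_basis 1 r n.+1 k.+1 x =
  pq_int 1 r n.+1 * x * pq_basis 1 r n k x.
Proof.
move=> kn; rewrite !pq_basis1E subSS /pq_binom subSS !pq_factS exprS.
by field; rewrite !fact_neq0 int_neq0.
Qed.

(** The q-Pascal rule, from [[n+1] = [n-k] + r^(n-k) [k+1]]. It reads as a Markov step from [n] to
    [n.+1]: the index [k] jumps to [k.+1] with weight [r ^+ (n - k) * x] and stays with the
    complementary weight. *)
Lemma pq_basis_pascal n k : (k < n)%N ->
  pq_basis 1 r n.+1 k.+1 x =
  r ^+ (n - k) * x * pq_basis 1 r n k x +
  (1 - r ^+ (n - k.+1) * x) * pq_basis 1 r n k.+1 x.
Proof.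
move=> kn; rewrite !pq_basis1E subSS /pq_binom.
have -> : (n.+1 - k.+1 = (n - k.+1).+1)%N by rewrite subSS subnSK.
rewrite -(subnSK kn); set m := (n - k.+1)%N.
have En : n = (k.+1 + m)%N by rewrite subnKC.
rewrite big_nat_recr//= !pq_factS.
have -> : pq_int 1 r n.+1 = pq_int 1 r m.+1 + r ^+ m.+1 * pq_int 1 r k.+1.
  by rewrite -pq_intD// En addSn -addSnnS addnC addSn.
move: (\prod_(_ <= _ < _) _) (fact_neq0 k) (fact_neq0 m) => P.
move: (int_neq0 k) (int_neq0 m).
move: (pq_fact 1 r k) (pq_fact 1 r m) (pq_int 1 r k.+1) (pq_int 1 r m.+1).
move=> a b c d c0 d0 a0 b0; rewrite !exprS.
by field; rewrite a0 b0 c0 d0.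
Qed.

Lemma pq_basis_0S n :
  pq_basis 1 r n.+1 0 x = (1 - r ^+ n * x) * pq_basis 1 r n 0 x.
Proof.
rewrite !pq_basis1E !subn0 /pq_binom !subn0 pq_fact0 !mul1r !divff//.
by rewrite big_nat_recr//= !expr0 !mul1r mulrC.
Qed.

Lemma pq_basis_nS n : pq_basis 1 r n.+1 n.+1 x = x * pq_basis 1 r n n x.
Proof.
rewrite !pq_basis1E /pq_binom !subnn pq_fact0 !mulr1 !divff//.
by rewrite !big_geq// !mul1r !mulr1 exprS.
Qed.

Lemma qmean1 n : qmean r n x (fun=> 1) = 1.
Proof.
rewrite /qmean; under eq_bigr do rewrite mulr1.
elim: n => [|n IH]; first by rewrite big_nat1 pq_basis0.
rewrite big_nat_recl// pq_basis_0S big_nat_recr//= pq_basis_nS.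
rewrite (eq_big_nat _ _ (F2 := fun k => r ^+ (n - k) * x * pq_basis 1 r n k x +
  (1 - r ^+ (n - k.+1) * x) * pq_basis 1 r n k.+1 x)); last first.
  by move=> k /andP[_ kn]; rewrite pq_basis_pascal.
rewrite big_split/=.
set S1 := \sum_(_ <= _ < _) _; set S2 := \sum_(_ <= _ < _) _.
(* With the two boundary terms, [S2] gathers all the mass that stays and [S1] all the mass that
   jumps; at each [k] the two weights add up to 1. *)
have E2 : (1 - r ^+ n * x) * pq_basis 1 r n 0 x + S2 =
    \sum_(0 <= k < n.+1) (1 - r ^+ (n - k) * x) * pq_basis 1 r n k x.
  by rewrite big_nat_recl// subn0.
have E1 : S1 + x * pq_basis 1 r n n x =
    \sum_(0 <= k < n.+1) r ^+ (n - k) * x * pq_basis 1 r n k x.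
  by rewrite big_nat_recr//= subnn expr0 mul1r.
transitivity (((1 - r ^+ n * x) * pq_basis 1 r n 0 x + S2) +
  (S1 + x * pq_basis 1 r n n x)); first by ring.
by rewrite E2 E1 -big_split/= -[RHS]IH; apply: eq_bigr => k _; ring.
Qed.

(** The term [k = 0] vanishes since [[0] = 0], and [pq_basis_absorb] applies to the shifted others.
    Each use trades one factor [[k]] for one degree. *)
Lemma qmean_absorb n G :
  qmean r n.+1 x (fun k => pq_int 1 r k * G k) =
  pq_int 1 r n.+1 * x * qmean r n x (fun k => G k.+1).
Proof.
rewrite /qmean big_nat_recl// pq_int0 mul0r mulr0 add0r mulr_sumr.
apply: eq_big_nat => k /andP[_ kn].
by rewrite mulrCA mulrA mulrA pq_basis_absorb// !mulrA.
Qed.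

Lemma qmeanD n G H :
  qmean r n x (fun k => G k + H k) = qmean r n x G + qmean r n x H.
Proof. by rewrite /qmean -big_split/=; apply: eq_bigr => k _; rewrite mulrDr. Qed.

Lemma qmeanZ n (c : R) G :
  qmean r n x (fun k => c * G k) = c * qmean r n x G.
Proof. by rewrite /qmean mulr_sumr; apply: eq_bigr => k _; rewrite mulrCA. Qed.

Lemma eq_qmean n G H : G =1 H -> qmean r n x G = qmean r n x H.
Proof. by move=> GH; apply: eq_bigr => k _; rewrite GH. Qed.

Let T k := pq_int 1 r k.

Lemma qmean_int1 n : qmean r n x T = T n * x.
Proof.
case: n => [|n].
  by rewrite /qmean big_nat1 /T pq_int0 mulr0 mul0r.
rewrite (@eq_qmean _ _ (fun k => T k * 1)); last by move=> k; rewrite mulr1.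
by rewrite qmean_absorb qmean1 mulr1.
Qed.

(** After one absorption the remaining factor is [T k.+1 = 1 + r * T k]. The third and fourth
    moments repeat this with the square and the cube of [1 + r * T k], each drawing on the lower
    moments one degree down; hence the shifts [n.+2] and [n.+3]. *)
Lemma qmean_int2 n :
  qmean r n.+1 x (fun k => T k ^+ 2) = T n.+1 * x * (1 + r * T n * x).
Proof.
rewrite (@eq_qmean _ _ (fun k => T k * T k)); last by move=> k; rewrite expr2.
rewrite qmean_absorb (@eq_qmean _ _ (fun k => 1 + r * T k)); last first.
  by move=> k; rewrite /T pq_intS.
by rewrite qmeanD qmeanZ qmean1 qmean_int1 -/T !mulrA.
Qed.

Lemma qmean_int3 n :
  qmean r n.+2 x (fun k => T k ^+ 3) = T n.+2 * x *
   (1 + 2 * r * T n.+1 * x + r ^+ 2 * T n.+1 * x * (1 + r * T n * x)).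
Proof.
rewrite (@eq_qmean _ _ (fun k => T k * T k ^+ 2)); last first.
  by move=> k; rewrite -exprS.
rewrite qmean_absorb -/(T _).
rewrite (@eq_qmean _ _ (fun k => 1 + (2 * r * T k + r ^+ 2 * T k ^+ 2)));
  last first.
  by move=> k; rewrite /T pq_intS//; ring.
by rewrite !qmeanD !qmeanZ qmean1 qmean_int1 qmean_int2; ring.
Qed.

Lemma qmean_int4 n :
  qmean r n.+3 x (fun k => T k ^+ 4) = T n.+3 * x *
   (1 + 3 * r * T n.+2 * x +
    3 * r ^+ 2 * T n.+2 * x * (1 + r * T n.+1 * x) +
    r ^+ 3 * T n.+2 * x *
      (1 + 2 * r * T n.+1 * x + r ^+ 2 * T n.+1 * x * (1 + r * T n * x))).
Proof.
rewrite (@eq_qmean _ _ (fun k => T k * T k ^+ 3)); last first.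
  by move=> k; rewrite -exprS.
rewrite qmean_absorb -/(T _).
rewrite (@eq_qmean _ _ (fun k => 1 + (3 * r * T k + (3 * r ^+ 2 * T k ^+ 2 +
  r ^+ 3 * T k ^+ 3)))); last first.
  by move=> k; rewrite /T pq_intS//; ring.
by rewrite !qmeanD !qmeanZ qmean1 qmean_int1 qmean_int2 qmean_int3; ring.
Qed.

Let node n k := T k / T n.

Lemma qmean_node_cst n : qmean r n.+1 x (fun k => node n.+1 k - x) = 0.
Proof.
rewrite (@eq_qmean _ _ (fun k => (T n.+1)^-1 * T k + - x * 1)); last first.
  by move=> k; rewrite mulr1 /node mulrC.
by rewrite qmeanD !qmeanZ qmean1 qmean_int1; field; exact: int_neq0.
Qed.

Lemma qmean_node_var n :
  qmean r n.+1 x (fun k => (node n.+1 k - x) ^+ 2) = (x - x ^+ 2) / T n.+1.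
Proof.
have h : T n.+1 != 0 by exact: int_neq0.
rewrite (@eq_qmean _ _ (fun k => (T n.+1)^-2 * T k ^+ 2 +
  (- 2 * x / T n.+1 * T k + x ^+ 2 * 1))); last first.
  by move=> k; rewrite /node; field.
rewrite !qmeanD !qmeanZ qmean1 qmean_int1 qmean_int2.
have E : T n.+1 = 1 + r * T n by rewrite /T pq_intS.
move: h; rewrite E => h; by field.
Qed.

(** The expansion in powers of [1 / N] shows that the only term without a factor [1 / N] carries
    [(1 - r) ^+ 2], so everything vanishes as [r] tends to 1 and [N] to infinity. *)
Lemma qmean_node_fourth n : let N := T n.+3 in
  qmean r n.+3 x (fun k => (node n.+3 k - x) ^+ 4) * N =
  x ^+ 3 * (1 - x) * (1 - r) ^+ 2 +
  x ^+ 2 * (1 - x) * (- (1 - x) + 3 * r + r ^+ 2 * (1 - 3 * x) - r ^+ 3 * x)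
    / N +
  x * (1 - x) * ((1 - x) ^+ 2 - r * x * (3 - 2 * x) -
    r ^+ 2 * x * (1 - 2 * x) + r ^+ 3 * x ^+ 2) / N ^+ 2.
Proof.
move=> N; have h : N != 0 by exact: int_neq0.
have E : N = 1 + r * T n.+2 by rewrite /N /T pq_intS.
have E2 : T n.+2 = 1 + r * T n.+1 by rewrite /T pq_intS.
have E1 : T n.+1 = 1 + r * T n by rewrite /T pq_intS.
(* The recurrences give [r T(n+2) = N - 1], [r^2 T(n+1) = N - 1 - r] and
   [r^3 T(n) = N - 1 - r - r^2], so the moments become polynomials in [N], [r] and [x] alone. *)
have m2 : qmean r n.+3 x (fun k => T k ^+ 2) = N * x * (1 + (N - 1) * x).
  by rewrite qmean_int2 -/N E; ring.
have m3 : qmean r n.+3 x (fun k => T k ^+ 3) =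
    N * x * (1 + 2 * (N - 1) * x + (N - 1) * x * (r + (N - 1 - r) * x)).
  by rewrite qmean_int3 -/N E E2; ring.
have m4 : qmean r n.+3 x (fun k => T k ^+ 4) =
    N * x * (1 + 3 * (N - 1) * x + 3 * (N - 1) * x * (r + (N - 1 - r) * x) +
    (N - 1) * x * (r ^+ 2 + 2 * r * (N - 1 - r) * x +
      (N - 1 - r) * x * (r ^+ 2 + (N - 1 - r - r ^+ 2) * x))).
  by rewrite qmean_int4 -/N E E2 E1; ring.
rewrite (@eq_qmean _ _ (fun k => N ^- 4 * T k ^+ 4 +
  (- 4 * x / N ^+ 3 * T k ^+ 3 + (6 * x ^+ 2 / N ^+ 2 * T k ^+ 2 +
  (- 4 * x ^+ 3 / N * T k + x ^+ 4 * 1))))); last first.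
  by move=> k; rewrite /node -/N; field.
rewrite !qmeanD !qmeanZ qmean1 qmean_int1 m2 m3 m4 -/N.
by field.
Qed.

End Moments.
End QBernstein.

(** * Second-order Taylor expansion on the square *)

Section Taylor.
Context {R : realType}.
Implicit Types (g : R -> R) (F f : R * R -> R).

(** Around an interior point, increments smaller than [t] and [1 - t] do not leave [0, 1], so the
    restricted and the ordinary limits agree. *)
Lemma is_derive_derive01 g (t : R) : 0 < t < 1 -> derivable01 g t ->
  is_derive t 1 g (derive01 g t).
Proof.
move=> /andP[t0 t1] dg.
suff H : (h : R)^-1 *: ((g \o shift t) (h *: (1 : R)) - g t) @[h --> 0^'] -->
    derive01 g t.
  by split; [exact: (cvgP _ H) | exact: cvg_lim H].
pose Q (s : R) := (g s - g t) / (s - t).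
have -> : (fun h : R => h^-1 *: ((g \o shift t) (h *: (1 : R)) - g t)) =
    Q \o (fun h => h + t).
  apply/funext => h /=; rewrite /Q addrK mulrC.
  by rewrite [h *: _]mulr1.
apply: cvg_comp dg => P /nbhs_ballP[e /= e0 eP].
apply/nbhs_ballP; exists (Num.min e (Num.min t (1 - t))) => /=.
  by rewrite !lt_min e0 t0 subr_gt0.
move=> h; rewrite /ball/= sub0r normrN !lt_min => /andP[he /andP[ht ht1]] h0.
apply: eP => /=.
- by rewrite /ball/= opprD addrCA subrr addr0 normrN.
- by rewrite -subr_eq0 addrK.
- rewrite in_itv/=; move: ht ht1; rewrite !ltr_norml => /andP[? ?] /andP[? ?].
  by apply/andP; split; lra.
Qed.

(** The mean value theorem for either order of [x] and [u]; the bound on [|s - x|] lets it be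
    iterated without leaving the range between them. *)
Lemma mvt01 g (dg : R -> R) (x u : R) : 0 <= x <= 1 -> 0 <= u <= 1 ->
  {within `[0, 1], continuous g} ->
  (forall t : R, 0 < t < 1 -> is_derive t 1 g (dg t)) ->
  exists s, [/\ 0 <= s <= 1, `|s - x| <= `|u - x| &
    g u - g x = dg s * (u - x)].
Proof.
move=> /andP[x0 x1] /andP[u0 u1] cg dgE.
have sub (a b : R) : 0 <= a -> b <= 1 -> a <= b ->
    exists2 s, s \in `[a, b] & g b - g a = dg s * (b - a).
  move=> a0 b1 ab; apply: MVT_segment => //.
    move=> t; rewrite in_itv/= => /andP[at_ tb]; apply: dgE.
    by rewrite (le_lt_trans a0)// (lt_le_trans tb).
  apply: continuous_subspaceW cg => t/=; rewrite !in_itv/= => /andP[at_ tb].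
  by rewrite (le_trans a0)// (le_trans tb).
have [xu|/ltW ux] := leP x u.
  have [s + sE] := sub _ _ x0 u1 xu; rewrite in_itv/= => /andP[xs su].
  exists s; split => //; first by apply/andP; split; lra.
  by rewrite !ger0_norm ?subr_ge0// lerD2r.
have [s + sE] := sub _ _ u0 x1 ux; rewrite in_itv/= => /andP[us sx].
exists s; split => //; first by apply/andP; split; lra.
- by rewrite !ler0_norm ?subr_le0// !opprB lerD2l lerN2.
- by rewrite -opprB sE -mulrN opprB.
Qed.

(** The number [c] need not be the second derivative at [x]: later it is the value at a fixed point
    of the square while [g] is a slice at another ordinate, and [M] absorbs the discrepancy. *)
Lemma taylor2_01 g (c M x u : R) : 0 <= x <= 1 -> 0 <= u <= 1 ->
  {within `[0, 1], continuous g} -> {within `[0, 1], continuous (derive01 g)} ->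
  (forall t : R, 0 <= t <= 1 -> derivable01 g t) ->
  (forall t : R, 0 <= t <= 1 -> derivable01 (derive01 g) t) ->
  (forall t : R, 0 <= t <= 1 -> `|t - x| <= `|u - x| ->
     `|derive01 (derive01 g) t - c| <= M) ->
  `|g u - g x - derive01 g x * (u - x) - c / 2 * (u - x) ^+ 2| <=
  M * (u - x) ^+ 2.
Proof.
move=> x01 u01 cg cg' dg dg' hM.
have M0 : 0 <= M by apply: (le_trans _ (hM x _ _)); rewrite ?subrr ?normr0.
(* Subtracting the quadratic model gives [h0' = h1 - h1 x] and [h1' = g'' - c]. Two mean value steps
   then write the remainder as [(g''(w) - c) (s - x) (u - x)]. *)
pose h1 (t : R) := derive01 g t - c * t.
pose h0 (t : R) := g t - (derive01 g x - c * x) * t - c / 2 * t ^+ 2.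
have itv (t : R) : 0 < t < 1 -> 0 <= t <= 1 by move=> /andP[/ltW -> /ltW].
have ch1 : {within `[0, 1], continuous h1}.
  apply/subspace_continuousP => t t01; apply: cvgB.
    by move/subspace_continuousP: cg'; exact.
  by apply: cvg_within_filter; exact: mulrl_continuous.
have ch0 : {within `[0, 1], continuous h0}.
  apply/subspace_continuousP => t t01; apply: cvgB; first apply: cvgB.
  - by move/subspace_continuousP: cg; exact.
  - by apply: cvg_within_filter; exact: mulrl_continuous.
  - apply: cvg_within_filter.
    by apply: cvgM; [exact: cvg_cst|exact: exprn_continuous].
have dh1 (t : R) : 0 < t < 1 -> is_derive t 1 h1 (derive01 (derive01 g) t - c).
  move=> t01; have := is_derive_derive01 _ _ t01 (dg' _ (itv _ t01)) => dt.
  rewrite /h1; apply: is_derive_eq.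
  by rewrite /GRing.scale/= mulr1.
have dh0 (t : R) : 0 < t < 1 -> is_derive t 1 h0 (h1 t - h1 x).
  move=> t01; have := is_derive_derive01 _ _ t01 (dg _ (itv _ t01)) => dt.
  rewrite /h0; apply: is_derive_eq.
  by rewrite /h1 /GRing.scale/= ?mulr1; field.
have [s [s01 su hs]] := mvt01 _ _ _ _ x01 u01 ch0 dh0.
have [w [w01 wu hw]] := mvt01 _ _ _ _ x01 s01 ch1 dh1.
have -> : g u - g x - derive01 g x * (u - x) - c / 2 * (u - x) ^+ 2 =
    h0 u - h0 x by rewrite /h0; field.
rewrite hs hw 2!normrM -mulrA ler_pM//.
  by rewrite hM// (le_trans wu).
by rewrite -(real_normK (num_real (u - x))) expr2 ler_wpM2r.
Qed.

(** Near [z] continuity gives [e]. Once a coordinate is at distance [d] or more, the sum of squares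
    is at least [d ^+ 2], so [C = 2 B / d^2] covers the crude bound [2 B] coming from
    compactness. *)
Lemma within_square_bound F (z : R * R) (e : R) :
  {within @unit_square R, continuous F} -> unit_square z -> 0 < e ->
  exists2 C, 0 <= C & forall t v : R, 0 <= t <= 1 -> 0 <= v <= 1 ->
    `|F (t, v) - F z| <= e + C * ((t - z.1) ^+ 2 + (v - z.2) ^+ 2).
Proof.
move=> cF sz e0.
have cpt : compact (@unit_square R).
  by apply: compact_setX; exact: segment_compact.
(* Boundedness holds for any number strictly above [M]; the maximum with 0 makes the chosen one
   nonnegative. *)
have [M [_ /(_ (Num.max M 0 + 1)) FM]] :=
  compact_bounded (continuous_compact cF cpt).
pose B := Num.max M 0 + 1.
have B0 : 0 <= B by rewrite /B addr_ge0// le_max lexx orbT.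
have FB t v : 0 <= t <= 1 -> 0 <= v <= 1 -> `|F (t, v)| <= B.
  move=> t01 v01; apply: FM; first by rewrite ltr_pwDr// le_max lexx.
  by exists (t, v) => //; split; rewrite /= in_itv.
have /subspace_continuousP/(_ z sz)/cvgrPdist_le/(_ e e0) := cF.
move=> /nbhs_ballP[d /= d0 dF].
exists (2 * B / d ^+ 2) => [|t v t01 v01].
  by rewrite divr_ge0 ?mulr_ge0 ?exprn_ge0// ltW.
have d20 : 0 < d ^+ 2 by rewrite exprn_gt0.
have [near|far] := boolP ((`|t - z.1| < d) && (`|v - z.2| < d)).
  apply: (@le_trans _ _ e).
    rewrite distrC; apply: dF; last by split; rewrite /= in_itv.
    by move: near => /andP[? ?]; split; rewrite /ball/= distrC.
  rewrite lerDl mulr_ge0// ?addr_ge0 ?sqr_ge0//.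
  by rewrite divr_ge0 ?mulr_ge0 ?exprn_ge0// ltW.
have far2 : d ^+ 2 <= (t - z.1) ^+ 2 + (v - z.2) ^+ 2.
  have sq (w : R) : d <= `|w| -> d ^+ 2 <= w ^+ 2.
    move=> dw; rewrite -(real_normK (num_real w)).
    by rewrite lerXn2r ?nnegrE ?(ltW d0).
  move: far; rewrite negb_and -!leNgt => /orP[/sq h|/sq h].
    by rewrite (le_trans h)// lerDl sqr_ge0.
  by rewrite (le_trans h)// lerDr sqr_ge0.
apply: (@le_trans _ _ (2 * B)).
  rewrite (le_trans (ler_normB _ _))// mulr2n mulrDl !mul1r lerD ?FB//.
  case: sz; rewrite /= !in_itv/= => z1 z2.
  by rewrite (surjective_pairing z) FB.
apply: (@le_trans _ _ (2 * B / d ^+ 2 * d ^+ 2)).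
  by rewrite divfK// gt_eqF.
rewrite (@le_trans _ _ (2 * B / d ^+ 2 * ((t - z.1) ^+ 2 + (v - z.2) ^+ 2)))//.
  by rewrite ler_wpM2l// divr_ge0 ?mulr_ge0 ?exprn_ge0// ltW.
by rewrite lerDr ltW.
Qed.

Lemma within_square_slices F : {within @unit_square R, continuous F} ->
  forall v : R, 0 <= v <= 1 ->
    {within `[0, 1], continuous (fun t => F (t, v))} /\
    {within `[0, 1], continuous (fun t => F (v, t))}.
Proof.
move=> /subspace_continuousP cF v v01; split; apply/subspace_continuousP => t t01.
- have /cF cFt : unit_square (t, v) by split => //=; rewrite in_itv.
  apply: (cvg_trans _ cFt) => P /nbhs_ballP[d /= d0 dP].
  apply/nbhs_ballP; exists d => //= s ds s01; apply: dP.
    by split => //=; exact: ballxx.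
  by split => //=; rewrite in_itv.
- have /cF cFt : unit_square (v, t) by split => //=; rewrite in_itv.
  apply: (cvg_trans _ cFt) => P /nbhs_ballP[d /= d0 dP].
  apply/nbhs_ballP; exists d => //= s ds s01; apply: dP.
    by split => //=; exact: ballxx.
  by split => //=; rewrite in_itv.
Qed.

(** The increment is split at [(x, v)]. The error is stated in even monomials because their means
    are products of second moments or fourth moments of the nodes. *)
Lemma taylor2_square f (x y e : R) : C2_square f ->
  0 <= x <= 1 -> 0 <= y <= 1 -> 0 < e ->
  exists2 C, 0 <= C & forall u v : R, 0 <= u <= 1 -> 0 <= v <= 1 ->
    `|f (u, v) - f (x, y) - partial1 f (x, v) * (u - x)
      - partial1 (partial1 f) (x, y) / 2 * (u - x) ^+ 2
      - partial2 f (x, y) * (v - y)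
      - partial2 (partial2 f) (x, y) / 2 * (v - y) ^+ 2| <=
    e * ((u - x) ^+ 2 + (v - y) ^+ 2) +
    C * ((u - x) ^+ 4 + (u - x) ^+ 2 * (v - y) ^+ 2 + (v - y) ^+ 4).
Proof.
move=> [cf [d1 c1 d11 c11] [d2 c2 d22 c22]] x01 y01 e0.
have sq (t v : R) : 0 <= t <= 1 -> 0 <= v <= 1 -> unit_square (t, v).
  by move=> t01 v01; split; rewrite /= in_itv.
have [C1 C10 B1] := within_square_bound _ _ _ c11 (sq _ _ x01 y01) e0.
have [C2 C20 B2] := within_square_bound _ _ _ c22 (sq _ _ x01 y01) e0.
have sqle (a b : R) : `|a| <= `|b| -> a ^+ 2 <= b ^+ 2.
  move=> ab; rewrite -(real_normK (num_real a)) -(real_normK (num_real b)).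
  by rewrite lerXn2r ?nnegrE.
exists (C1 + C2) => [|u v u01 v01]; first exact: addr_ge0.
have T1 := taylor2_01 (fun t => f (t, v)) (partial1 (partial1 f) (x, y))
  (e + C1 * ((u - x) ^+ 2 + (v - y) ^+ 2)) x u x01 u01
  (within_square_slices _ cf _ v01).1 (within_square_slices _ c1 _ v01).1
  (fun t t01 => d1 (t, v) (sq _ _ t01 v01))
  (fun t t01 => d11 (t, v) (sq _ _ t01 v01)).
have T2 := taylor2_01 (fun t => f (x, t)) (partial2 (partial2 f) (x, y))
  (e + C2 * (v - y) ^+ 2) y v y01 v01
  (within_square_slices _ cf _ x01).2 (within_square_slices _ c2 _ x01).2
  (fun t t01 => d2 (x, t) (sq _ _ x01 t01))
  (fun t t01 => d22 (x, t) (sq _ _ x01 t01)).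
(* Intermediate points satisfy [|t - x| <= |u - x|], so [u] may replace [t] in the bound [B1]. *)
have {}T1 := T1 (fun t t01 tu => le_trans (B1 t v t01 v01)
   (lerD (lexx _) (ler_wpM2l C10 (lerD (sqle _ _ tu) (lexx _))))).
have {}T2 : `|f (x, v) - f (x, y) - partial2 f (x, y) * (v - y) -
    partial2 (partial2 f) (x, y) / 2 * (v - y) ^+ 2| <=
    (e + C2 * (v - y) ^+ 2) * (v - y) ^+ 2.
  apply: T2 => t t01 tv; apply: (le_trans (B2 x t x01 t01)).
  by rewrite lerD// subrr expr0n/= add0r ler_wpM2l// sqle.
have {}T1 : `|f (u, v) - f (x, v) - partial1 f (x, v) * (u - x) -
    partial1 (partial1 f) (x, y) / 2 * (u - x) ^+ 2| <=
    (e + C1 * ((u - x) ^+ 2 + (v - y) ^+ 2)) * (u - x) ^+ 2 by exact: T1.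
set a1 := partial1 f (x, v) in T1 *; set a2 := partial2 f (x, y) in T2 *.
set b1 := partial1 _ _ in T1 *; set b2 := partial2 _ _ in T2 *.
rewrite (_ : f (u, v) - f (x, y) - _ - _ - _ - _ =
  (f (u, v) - f (x, v) - a1 * (u - x) - b1 / 2 * (u - x) ^+ 2) +
  (f (x, v) - f (x, y) - a2 * (v - y) - b2 / 2 * (v - y) ^+ 2)); last by ring.
apply: (le_trans (ler_normD _ _)); apply: (le_trans (lerD T1 T2)).
(* Giving all three monomials the coefficient [C1 + C2] leaves a surplus that is a sum of
   nonnegative terms. *)
rewrite -subr_ge0; set X := (u - x); set Y := (v - y).
rewrite (_ : _ - _ = C2 * (X ^+ 2 * X ^+ 2) + C2 * (X ^+ 2 * Y ^+ 2) +
  C1 * (Y ^+ 2 * Y ^+ 2)); last by ring.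
by rewrite !addr_ge0// mulr_ge0// mulr_ge0// sqr_ge0.
Qed.

End Taylor.

(** * Explicit error bound at a fixed degree *)

Section Estimate.
Context {R : realType}.
Implicit Types (p q r x y : R) (f : R * R -> R) (n k : nat).

Lemma pq_node_itv r n k : 0 < r -> r < 1 -> (k <= n.+1)%N ->
  0 <= pq_int 1 r k / pq_int 1 r n.+1 <= 1.
Proof.
move=> r0 r1 kn; have N0 : 0 < pq_int 1 r n.+1 by rewrite pq_int_gt0.
have T0 m : 0 <= pq_int 1 r m.
  by case: m => [|m]; rewrite ?pq_int0// ltW// pq_int_gt0.
rewrite divr_ge0//= ler_pdivrMr// mul1r -(subnKC kn) pq_intD ?lt_eqF//.
by rewrite lerDl mulr_ge0// exprn_ge0// ltW.
Qed.

(** With [m = n.+1], the geometric sum gives [m r^m <= [m]], so [1 = [m] (1 - r) + r^m <= [m] (1 -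
    r) + [m] / m]; then divide by [[m]]. *)
Lemma pq_int_invr_le r n : 0 < r -> r < 1 ->
  (pq_int 1 r n.+1)^-1 <= n.+1%:R^-1 + (1 - r).
Proof.
move=> r0 r1; have rn1 : r != 1 by rewrite lt_eqF.
have N0 : 0 < pq_int 1 r n.+1 by rewrite pq_int_gt0.
have n0 : (0 : R) < n.+1%:R by rewrite ltr0n.
have lower m : m%:R * r ^+ m <= pq_int 1 r m.
  elim: m => [|m IH]; first by rewrite pq_int0 mul0r.
  rewrite pq_intS// -natr1 mulrDl mul1r addrC lerD//.
    by rewrite exprn_ile1// ltW.
  by rewrite exprS mulrCA ler_wpM2l// ltW.
have geom : pq_int 1 r n.+1 * (1 - r) = 1 - r ^+ n.+1.
  by rewrite /pq_int expr1n divfK// subr_eq0 eq_sym.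
rewrite -(ler_pM2l N0) mulfV ?gt_eqF// mulrDr geom.
have : r ^+ n.+1 <= pq_int 1 r n.+1 / n.+1%:R by rewrite ler_pdivlMr// mulrC.
by move: (_ / _) (r ^+ _) => a b; lra.
Qed.

(** The three terms of [qmean_node_fourth] are at most [1 - r], [4 / N] and [3 / N^2], and [N >= 1];
    hence 7 = 4 + 3. *)
Lemma qmean_node_fourth_le r x n : 0 < r -> r < 1 -> 0 <= x <= 1 ->
  pq_int 1 r n.+3 *
    qmean r n.+3 x (fun k => (pq_int 1 r k / pq_int 1 r n.+3 - x) ^+ 4) <=
  (1 - r) + 7 / pq_int 1 r n.+3.
Proof.
move=> r0 r1 /andP[x0 x1]; rewrite mulrC; set N := pq_int 1 r n.+3.
have := qmean_node_fourth r x r0 r1 n; cbv zeta; rewrite -/N => ->.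
have rn1 : r != 1 by rewrite lt_eqF.
have N0 : 0 < N by rewrite pq_int_gt0.
have T0 : 0 <= pq_int 1 r n.+2 by rewrite ltW ?pq_int_gt0.
have N1 : N^-1 <= 1.
  by rewrite invf_le1// /N pq_intS// lerDl mulr_ge0// ltW.
have u0 : 0 <= N^-1 by rewrite invr_ge0 ltW.
(* Monomials in [x], [1 - x] and [r] stay in [0, 1]; taken as atoms, they turn the polynomial bounds
   below into linear ones. *)
have itv (a b : R) : 0 <= a <= 1 -> 0 <= b <= 1 -> 0 <= a * b <= 1.
  by move=> /andP[? ?] /andP[? ?]; rewrite mulr_ge0 ?mulr_ile1.
have hx : 0 <= x <= 1 by rewrite x0.
have hy : 0 <= 1 - x <= 1 by lra.
have hr : 0 <= r <= 1 by rewrite !ltW.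
have hs : 0 <= 1 - r <= 1 by lra.
have A1 : x ^+ 3 * (1 - x) * (1 - r) ^+ 2 <= 1 - r.
  have /andP[_ h] : 0 <= x * (x * (x * ((1 - x) * (1 - r)))) <= 1 by rewrite !itv.
  rewrite [leLHS](_ : _ = x * (x * (x * ((1 - x) * (1 - r)))) * (1 - r));
    last by ring.
  by rewrite ler_piMl//; lra.
have A2 : x ^+ 2 * (1 - x) * (- (1 - x) + 3 * r + r ^+ 2 * (1 - 3 * x) -
    r ^+ 3 * x) <= 4.
  have /andP[b0 b1] : 0 <= x * (x * (1 - x)) <= 1 by rewrite !itv.
  have /andP[? ?] : 0 <= r * r <= 1 by exact: itv.
  have /andP[? ?] : 0 <= r * (r * x) <= 1 by rewrite !itv.
  have /andP[? ?] : 0 <= r * (r * (r * x)) <= 1 by rewrite !itv.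
  rewrite (_ : x ^+ 2 * (1 - x) = x * (x * (1 - x))); last by ring.
  rewrite (@le_trans _ _ (x * (x * (1 - x)) * 4))//; last by lra.
  rewrite ler_wpM2l//.
  rewrite (_ : r ^+ 2 * _ = r * r - 3 * (r * (r * x))); last by ring.
  rewrite (_ : r ^+ 3 * x = r * (r * (r * x))); last by ring.
  lra.
have A3 : x * (1 - x) * ((1 - x) ^+ 2 - r * x * (3 - 2 * x) -
    r ^+ 2 * x * (1 - 2 * x) + r ^+ 3 * x ^+ 2) <= 3.
  have /andP[b0 b1] : 0 <= x * (1 - x) <= 1 by rewrite !itv.
  have /andP[? ?] : 0 <= (1 - x) * (1 - x) <= 1 by exact: itv.
  have /andP[? ?] : 0 <= r * (r * (r * (x * x))) <= 1 by rewrite !itv.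
  have /andP[? ?] : 0 <= r * (r * (x * (1 - x))) <= 1 by rewrite !itv.
  have /andP[? ?] : 0 <= r * (r * (x * x)) <= 1 by rewrite !itv.
  have /andP[? ?] : 0 <= r * (x * (1 - x)) <= 1 by rewrite !itv.
  have /andP[? ?] : 0 <= r * x <= 1 by rewrite !itv.
  rewrite (@le_trans _ _ (x * (1 - x) * 3))//; last by lra.
  rewrite ler_wpM2l//.
  rewrite (_ : (1 - x) ^+ 2 = (1 - x) * (1 - x)); last by ring.
  rewrite (_ : r * x * (3 - 2 * x) = r * x + 2 * (r * (x * (1 - x))));
    last by ring.
  rewrite (_ : r ^+ 2 * x * (1 - 2 * x) = r * (r * (x * (1 - x))) -
    r * (r * (x * x))); last by ring.
  rewrite (_ : r ^+ 3 * x ^+ 2 = r * (r * (r * (x * x)))); last by ring.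
  lra.
have A4 : N^-1 ^+ 2 <= N^-1 by rewrite expr2 ler_piMl.
rewrite -exprVn -addrA lerD//.
apply: (@le_trans _ _ (4 * N^-1 + 3 * N^-1)); last by lra.
rewrite lerD ?ler_wpM2r// (le_trans (ler_wpM2r _ A3)) ?exprn_ge0//.
by rewrite ler_wpM2l.
Qed.

Lemma qmean_ler r x n (G H : nat -> R) : 0 < r -> r < 1 -> 0 <= x <= 1 ->
  (forall k, (k <= n)%N -> G k <= H k) -> qmean r n x G <= qmean r n x H.
Proof.
move=> r0 r1 x01 GH; apply: ler_sum_nat => k /andP[_ kn].
by rewrite ler_wpM2l ?pq_basis_ge0// GH.
Qed.

Lemma ler_norm_qmean r x n (G : nat -> R) : 0 < r -> r < 1 -> 0 <= x <= 1 ->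
  `|qmean r n x G| <= qmean r n x (fun k => `|G k|).
Proof.
move=> r0 r1 x01; apply: (le_trans (ler_norm_sum _ _ _)).
apply: ler_sum_nat => k _.
by rewrite normrM ger0_norm ?pq_basis_ge0.
Qed.

Lemma pq_bernstein2E p q n f x y : 0 < q -> q < p ->
  let N := pq_int 1 (q / p) in
  pq_bernstein2 p q n.+1 f (x, y) =
  qmean (q / p) n.+1 x (fun k => qmean (q / p) n.+1 y (fun j =>
    f (N k / N n.+1, N j / N n.+1))).
Proof.
move=> q0 qp N; have p0 : p != 0 by rewrite gt_eqF// (lt_trans q0).
have pq : p != q by rewrite gt_eqF.
rewrite /pq_bernstein2 /qmean; apply: eq_big_nat => k /andP[_ kn].
rewrite mulr_sumr; apply: eq_big_nat => j /andP[_ jn] /=.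
rewrite (pq_basisE _ _ n.+1 k _ p0 pq kn) (pq_basisE _ _ n.+1 j _ p0 pq jn).
by rewrite (pq_nodeE _ _ _ _ p0 pq) (pq_nodeE _ _ _ _ p0 pq) mulrA.
Qed.

(** After multiplication by [N], the two variances contribute at most [2 e]; the two fourth moments
    give [2 (1 - r) + 14 / N] and the cross term at most [1 / N], hence 15. *)
Lemma qmean2_estimate r x y n f (A : R -> R) (F B c d e C : R) :
  0 < r -> r < 1 -> 0 <= x <= 1 -> 0 <= y <= 1 -> 0 < e -> 0 <= C ->
  (forall u v : R, 0 <= u <= 1 -> 0 <= v <= 1 ->
    `|f (u, v) - F - A v * (u - x) - c / 2 * (u - x) ^+ 2
      - B * (v - y) - d / 2 * (v - y) ^+ 2| <=
    e * ((u - x) ^+ 2 + (v - y) ^+ 2) +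
    C * ((u - x) ^+ 4 + (u - x) ^+ 2 * (v - y) ^+ 2 + (v - y) ^+ 4)) ->
  `|pq_int 1 r n.+3 * (qmean r n.+3 x (fun k => qmean r n.+3 y (fun j =>
      f (pq_int 1 r k / pq_int 1 r n.+3, pq_int 1 r j / pq_int 1 r n.+3))) - F)
    - (c / 2 * (x - x ^+ 2) + d / 2 * (y - y ^+ 2))| <=
  2 * e + C * (2 * (1 - r) + 15 / pq_int 1 r n.+3).
Proof.
move=> r0 r1 x01 y01 e0 C0 taylor.
set N := pq_int 1 r n.+3; pose t k := pq_int 1 r k / N.
have N0 : 0 < N by rewrite pq_int_gt0.
have Nn0 : N != 0 by rewrite gt_eqF.
have t01 k : (k <= n.+3)%N -> 0 <= t k <= 1 by exact: pq_node_itv.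
pose Ex := qmean r n.+3 x; pose Ey := qmean r n.+3 y.
have x1 : Ex (fun k => t k - x) = 0 by exact: qmean_node_cst.
have y1 : Ey (fun k => t k - y) = 0 by exact: qmean_node_cst.
have x2 : Ex (fun k => (t k - x) ^+ 2) = (x - x ^+ 2) / N.
  exact: qmean_node_var.
have y2 : Ey (fun k => (t k - y) ^+ 2) = (y - y ^+ 2) / N.
  exact: qmean_node_var.
have x4 : N * Ex (fun k => (t k - x) ^+ 4) <= (1 - r) + 7 / N.
  exact: qmean_node_fourth_le.
have y4 : N * Ey (fun k => (t k - y) ^+ 4) <= (1 - r) + 7 / N.
  exact: qmean_node_fourth_le.
pose rem k j := f (t k, t j) - F - A (t j) * (t k - x)
  - c / 2 * (t k - x) ^+ 2 - B * (t j - y) - d / 2 * (t j - y) ^+ 2.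
pose bnd k j := e * ((t k - x) ^+ 2 + (t j - y) ^+ 2) +
  C * ((t k - x) ^+ 4 + (t k - x) ^+ 2 * (t j - y) ^+ 2 + (t j - y) ^+ 4).
set S := qmean _ _ _ _; set m4x := Ex _ in x4; set m4y := Ey _ in y4.
have SE : Ex (fun k => Ey (fun j => f (t k, t j))) = S by [].
have remE : Ex (fun k => Ey (rem k)) =
    S - F - c / 2 * ((x - x ^+ 2) / N) - d / 2 * ((y - y ^+ 2) / N).
  (* The mean over [v] turns the moving slope into a constant [a], which then multiplies the
     vanishing first moment in [u]. *)
  pose a := Ey (A \o t).
  rewrite /Ex (@eq_qmean _ _ _ _ _ (fun k => Ey (fun j => f (t k, t j)) +
    (- a * (t k - x) + (- (c / 2) * (t k - x) ^+ 2 +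
      (- F - d / 2 * ((y - y ^+ 2) / N)) * 1)))) => [|k].
    by rewrite !qmeanD !qmeanZ qmean1// -/Ex x1 x2 SE; ring.
  rewrite /Ey (@eq_qmean _ _ _ _ _ (fun j => f (t k, t j) +
    (- (t k - x) * (A \o t) j + (- B * (t j - y) +
    (- (d / 2) * (t j - y) ^+ 2 + (- F - c / 2 * (t k - x) ^+ 2) * 1))))).
    by rewrite !qmeanD !qmeanZ qmean1// -/Ey y1 y2 /a; ring.
  by move=> j; rewrite /rem/=; ring.
have bndE : Ex (fun k => Ey (bnd k)) =
    e * ((x - x ^+ 2) / N + (y - y ^+ 2) / N) +
    C * (m4x + (x - x ^+ 2) / N * ((y - y ^+ 2) / N) + m4y).
  rewrite /Ex (@eq_qmean _ _ _ _ _ (fun k => C * (t k - x) ^+ 4 +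
    ((e + C * ((y - y ^+ 2) / N)) * (t k - x) ^+ 2 +
      (e * ((y - y ^+ 2) / N) + C * m4y) * 1))) => [|k].
    by rewrite !qmeanD !qmeanZ qmean1// -/Ex x2 /m4x; ring.
  rewrite /Ey (@eq_qmean _ _ _ _ _ (fun j => C * (t j - y) ^+ 4 +
    ((e + C * (t k - x) ^+ 2) * (t j - y) ^+ 2 +
      (e * (t k - x) ^+ 2 + C * (t k - x) ^+ 4) * 1))).
    by rewrite !qmeanD !qmeanZ qmean1// -/Ey y2 /m4y; ring.
  by move=> j; rewrite /bnd; ring.
have rem_le : `|Ex (fun k => Ey (rem k))| <= Ex (fun k => Ey (bnd k)).
  apply: (le_trans (ler_norm_qmean _ _ _ _ r0 r1 x01)).
  apply: qmean_ler => // k kn.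
  apply: (le_trans (ler_norm_qmean _ _ _ _ r0 r1 y01)).
  by apply: qmean_ler => // j jn; apply: taylor; apply: t01.
rewrite (_ : N * _ - _ = N * Ex (fun k => Ey (rem k))); last first.
  by rewrite remE; field.
rewrite normrM (gtr0_norm N0).
apply: (le_trans (ler_wpM2l (ltW N0) rem_le)); rewrite bndE.
have sq01 (w : R) : 0 <= w <= 1 -> 0 <= w - w ^+ 2 <= 1.
  move=> /andP[w0 w1]; have := mulr_ge0 w0 w0; have := ler_piMl w0 w1.
  by rewrite -expr2 => ? ?; apply/andP; split; lra.
have /andP[px0 px1] := sq01 _ x01; have /andP[py0 py1] := sq01 _ y01.
rewrite (_ : N * _ = e * (x - x ^+ 2 + (y - y ^+ 2)) +
  C * (N * m4x + (x - x ^+ 2) * (y - y ^+ 2) / N + N * m4y)); last by field.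
apply: lerD.
  by rewrite mulrC ler_wpM2r ?(ltW e0)//; lra.
rewrite ler_wpM2l//.
have u0 : 0 <= N^-1 by rewrite invr_ge0 ltW.
have : (x - x ^+ 2) * (y - y ^+ 2) / N <= N^-1.
  by rewrite ler_piMl// mulr_ile1.
lra.
Qed.

End Estimate.

(** * Passage to the limit *)

Theorem theorem3p7 (R : realType) (p q : nat -> R) (a b : R)
    (hpq : forall n : nat, (0 < n)%N -> 0 < q n /\ q n < p n /\ p n <= 1)
    (hp : p n @[n --> \oo] --> (1 : R))
    (hq : q n @[n --> \oo] --> (1 : R))
    (ha : p n ^+ n @[n --> \oo] --> a)
    (hb : q n ^+ n @[n --> \oo] --> b)
    (f : R * R -> R) (hf : C2_square f)
    (x y : R) (hx : 0 <= x <= 1) (hy : 0 <= y <= 1) :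
  pq_int (p n) (q n) n * (pq_bernstein2 (p n) (q n) n f (x, y) - f (x, y))
    @[n --> \oo] -->
  (a * x - a * x ^+ 2) / 2 * partial1 (partial1 f) (x, y) +
  (a * y - a * y ^+ 2) / 2 * partial2 (partial2 f) (x, y).
Proof.
pose r n := q n / p n; pose N n := pq_int 1 (r n) n.
pose c := partial1 (partial1 f) (x, y); pose d := partial2 (partial2 f) (x, y).
pose D n := pq_bernstein2 (p n) (q n) n f (x, y) - f (x, y).
have r_1 : r n @[n --> \oo] --> (1 : R).
  rewrite -[X in _ --> X]divr1.
  by apply: cvgM => //; apply: cvgV => //; rewrite oner_neq0.
have inv_0 : (n%:R^-1 : R) @[n --> \oo] --> (0 : R).
  by rewrite -cvg_shiftS; exact: cvg_harmonic.
have main : N n * D n @[n --> \oo] -->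
    c / 2 * (x - x ^+ 2) + d / 2 * (y - y ^+ 2).
  apply/cvgrPdist_le => eps eps0.
  have [|C C0 taylor] := taylor2_square f x y (eps / 4) hf hx hy.
    by rewrite divr_gt0.
  (* This is the [C] term of [qmean2_estimate], with [1 / N] replaced by its bound from
     [pq_int_invr_le]; the other term is [2 (eps / 4) = eps / 2]. *)
  pose err n := C * (2 * (1 - r n) + 15 * (n%:R^-1 + (1 - r n))).
  have err_0 : err n @[n --> \oo] --> (0 : R).
    have r0 : (1 - r n) @[n --> \oo] --> (0 : R).
      by rewrite -[X in _ --> X](subrr 1); apply: cvgB => //; exact: cvg_cst.
    have -> : (0 : R) = C * (2 * 0 + 15 * (0 + 0)) by ring.
    apply: cvgM; first exact: cvg_cst.
    apply: cvgD; apply: cvgM => //; try exact: cvg_cst.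
    exact: cvgD.
  have err_le : \forall n \near \oo, `|err n| <= eps / 2.
    have e2 : 0 < eps / 2 by rewrite divr_gt0.
    by move/cvgrPdist_le: err_0 => /(_ _ e2); under eq_near do rewrite sub0r normrN.
  (* The fourth moment formula requires a degree of at least 3. *)
  suff key m : `|err m.+3| <= eps / 2 -> `|N m.+3 * D m.+3 -
      (c / 2 * (x - x ^+ 2) + d / 2 * (y - y ^+ 2))| <= eps.
    near=> n; rewrite distrC -(@subnK 3 n); last by near: n; exact: nbhs_infty_ge.
    rewrite addn3; apply: key; rewrite -addn3 subnK; first by near: n.
    by near: n; exact: nbhs_infty_ge.
  have [q0 [qp p1]] := hpq m.+3 isT.
  have p0 : 0 < p m.+3 by rewrite (lt_trans q0).
  have r0 : 0 < r m.+3 by rewrite divr_gt0.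
  have r1 : r m.+3 < 1 by rewrite ltr_pdivrMr// mul1r.
  move=> /(le_trans (ler_norm _)) en.
  rewrite /D pq_bernstein2E//.
  have e4 : 0 < eps / 4 by rewrite divr_gt0.
  have := qmean2_estimate _ _ _ m _ _ _ _ _ _ _ _ r0 r1 hx hy e4 C0 taylor.
  move=> /le_trans; apply.
  rewrite [leRHS](_ : eps = 2 * (eps / 4) + eps / 2); last by field.
  rewrite lerD2l.
  rewrite (le_trans _ en)// ler_wpM2l// lerD2l// ler_wpM2l//.
  exact: pq_int_invr_le.
(* The form [a / 1] is the limit of [p n ^+ n / p n], that is of [p_n^(n-1)], the ratio of
   [[n]_(p,q)] to [N n]. *)
have -> : (a * x - a * x ^+ 2) / 2 * partial1 (partial1 f) (x, y) +
    (a * y - a * y ^+ 2) / 2 * partial2 (partial2 f) (x, y) =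
    a / 1 * (c / 2 * (x - x ^+ 2) + d / 2 * (y - y ^+ 2)).
  by rewrite /c /d; field.
have : (p n ^+ n / p n) * (N n * D n) @[n --> \oo] -->
    a / 1 * (c / 2 * (x - x ^+ 2) + d / 2 * (y - y ^+ 2)).
  apply: cvgM => //; apply: cvgM => //.
  by apply: cvgV => //; rewrite oner_neq0.
apply: cvg_trans; apply: near_eq_cvg; near=> n.
rewrite -(@prednK n); last by near: n; exact: nbhs_infty_gt.
move: n.-1 => m; have [q0 [qp _]] := hpq m.+1 isT.
have p0 : p m.+1 != 0 by rewrite gt_eqF// (lt_trans q0).
have pq : p m.+1 != q m.+1 by rewrite gt_eqF.
rewrite (pq_intE _ _ m p0 pq) /N /D mulrA; congr (_ * _ * _).
by rewrite exprS; field.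
Unshelve. all: by end_near.
Qed.
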